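(* Let $0<a\le b\le c$ and let $B\subset\mathbb{R}^3$ be a rectangular box with edge lengths $a,b,c$. Let $\lambda>0$. If a box $\lambda B$ (a copy of $B$ scaled by the factor $\lambda$) can be passed through $B$ by translation, then the interior of $B$ contains a rectangle with side lengths $\lambda a$ and $\lambda b$. In other words, the problem of finding the Nieuwland constant of $B$ is equivalent to the problem of finding the supremum of those $\lambda>0$ for which the interior of $B$ contains a rectangle with side lengths $\lambda a$ and $\lambda b$ (a copy, scaled by $\lambda$, of the smallest face of $B$): the Nieuwland constant of $B$ is equal to this supremum.
   Context: A rectangular box is a solid (closed) rectangular parallelepiped; rectangles are closed two-dimensional regions, placed in $\mathbb{R}^3$ in any position and orientation. For a nonzero vector $v$, let $\pi_v$ denote the orthogonal projection of $\mathbb{R}^3$ onto the plane through the origin perpendicular to $v$. Here $\lambda B$ denotes a rectangular box with edge lengths $\lambda a,\lambda b,\lambda c$, which may be placed in any position and orientation (i.e. any box similar to $B$ with ratio $\lambda$). The box $\lambda B$ can be passed through $B$ by translation if, for some direction $v\ne 0$, a straight tunnel parallel to $v$ can be cut in $B$ through which a suitably placed $\lambda B$ can be translated in the direction $v$; that is, if there are a vector $v\neq 0$ and a placement $B'$ of $\lambda B$ such that $\pi_v(B')$ is contained in the interior of $\pi_v(B)$ relative to the plane $v^\perp$. The Nieuwland constant of $B$ is the supremum of all $\lambda>0$ such that $\lambda B$ can be passed through $B$ by translation. *)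

(* Defs.v *)
From HB Require Import structures.
From mathcomp Require Import all_boot all_order all_algebra.
From mathcomp Require Import all_classical all_reals all_analysis.
Import Order.TTheory GRing.Theory Num.Theory numFieldNormedType.Exports.

Set Implicit Arguments.
Unset Strict Implicit.
Unset Printing Implicit Defensive.

Local Open Scope classical_set_scope.
Local Open Scope ring_scope.

(* Points and vectors of R^3 are row vectors 'rV[R]_3.  The library norm on
   this type is the sup norm, so it is used only for its topology; lengths and
   angles come from the Euclidean inner product [dot]. *)

Section Boxes.
Variable R : realType.

Definition dot (u v : 'rV[R]_3) : R := (u *m v^T) 0 0.

(* The rows of U, when orthonormal, are the directions of the edges issued
   from the vertex p, and s lists the corresponding edge lengths. *)
Definition orthotope (k : nat) (p : 'rV[R]_3) (U : 'M[R]_(k, 3))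
    (s : k.-tuple R) : set 'rV[R]_3 :=
  [set p + x *m U | x in [set x : 'rV[R]_k | forall i, 0 <= x 0 i <= tnth s i]].

Definition is_orthotope (k : nat) (s : k.-tuple R) (S : set 'rV[R]_3) : Prop :=
  exists (p : 'rV[R]_3) (U : 'M[R]_(k, 3)),
    U *m U^T = 1%:M /\ S = orthotope p U s.

Definition is_box (a b c : R) (B : set 'rV[R]_3) : Prop :=
  is_orthotope [tuple a; b; c] B.

Definition is_rectangle (a b : R) (Q : set 'rV[R]_3) : Prop :=
  is_orthotope [tuple a; b] Q.

Definition normal_plane (v : 'rV[R]_3) : set 'rV[R]_3 :=
  [set x | dot x v = 0].

Definition proj (v x : 'rV[R]_3) : 'rV[R]_3 := x - (dot x v / dot v v) *: v.

(* In the library, [subspace P] has the whole ambient type as carrier, with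
   the points outside P isolated; the interior taken in it is the interior
   relative to P for subsets of P, such as shadows on P. *)
Definition rel_interior (P A : set 'rV[R]_3) : set 'rV[R]_3 :=
  interior (A : set (subspace P)).

(* [B] is meant to be a box with edge lengths a, b, c, which the scaled copy
   [B'] has to refer to. *)
Definition passes_through (a b c lambda : R) (B : set 'rV[R]_3) : Prop :=
  exists (v : 'rV[R]_3) (B' : set 'rV[R]_3),
    [/\ v != 0,
        is_box (lambda * a) (lambda * b) (lambda * c) B' &
        proj v @` B' `<=` rel_interior (normal_plane v) (proj v @` B)].

Definition interior_contains_rectangle (a b : R) (B : set 'rV[R]_3) : Prop :=
  exists Q : set 'rV[R]_3, is_rectangle a b Q /\ Q `<=` interior B.

(* The suprema are taken in the extended reals, where no convention is needed
   for empty or unbounded sets. *)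
Definition nieuwland (a b c : R) (B : set 'rV[R]_3) : \bar R :=
  ereal_sup [set lambda%:E | lambda in
    [set lambda : R | 0 < lambda /\ passes_through a b c lambda B]].

Definition rectangle_sup (a b : R) (B : set 'rV[R]_3) : \bar R :=
  ereal_sup [set lambda%:E | lambda in
    [set lambda : R | 0 < lambda /\
      interior_contains_rectangle (lambda * a) (lambda * b) B]].

End Boxes.

(* Main.v *)
Require Import Defs.
From HB Require Import structures.
From mathcomp Require Import all_boot all_order all_algebra.
From mathcomp Require Import all_classical all_reals all_analysis.
From mathcomp Require Import ring lra.
Import Order.TTheory GRing.Theory Num.Theory numFieldNormedType.Exports.

(* A rectangle Q in the interior of B gives a passage along the normal of Q,
   since the box erected on Q has the same shadow as Q.

   Conversely, let lambda B pass through B along the unit vector v.  The shadow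
   of lambda B contains a rectangle with sides lambda a and lambda b: rotate the
   axis e_i of the box to v by the minimal rotation; a rectangle spanned by the
   images f_j, f_k of the other two axes differs from its lift along v, spanned
   by e_j - w_j / (1 + w_i) e_i and its analogue for k, where the w's are the
   coordinates of v, and the lift fits in the box as soon as
   |w_j| + |w_k| <= 1 + w_i and the i-th edge is at least b.  Taking for i the
   larger of the coordinates of v along the edges b and c always works.
   So this rectangle lies in the open shadow of B and its vertices lift to the
   open box B; after symmetrising about the center of B the lifts span a
   parallelogram inside B which projects orthogonally onto a rectangle.  Such a
   parallelogram contains a congruent copy of the rectangle, placed with a side
   along a side of the parallelogram or with a diagonal along a diagonal. *)

Set Implicit Arguments.
Unset Strict Implicit.

Local Open Scope classical_set_scope.
Local Open Scope ring_scope.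

(** * Rectangles inside a stretched rectangle *)

(* For orthonormal f1, f2, v put m1 = f1 + s v and m2 = f2 + t v.  The vectors
   g_i = x_i m1 + y_i m2 are orthonormal, and the centered rectangle with sides
   A g1 and B g2 lies in the centered parallelogram with sides A m1 and B m2. *)
Definition parallelogram_frame (R : rcfType) (A B s t x1 y1 x2 y2 : R) :=
  [/\ x1 ^+ 2 + y1 ^+ 2 + (x1 * s + y1 * t) ^+ 2 = 1,
      x2 ^+ 2 + y2 ^+ 2 + (x2 * s + y2 * t) ^+ 2 = 1,
      x1 * x2 + y1 * y2 + (x1 * s + y1 * t) * (x2 * s + y2 * t) = 0,
      A * `|x1| + B * `|x2| <= A &
      A * `|y1| + B * `|y2| <= B].

(* The frame obtained from m1, m2 by Gram-Schmidt; M = |m1|, and k is the area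
   spanned by m1 and m2. *)
Lemma side_aligned (R : rcfType) (A B s t k M : R) :
  0 < A -> 0 < B -> 0 <= s * t -> 0 < k -> 0 < M ->
  k ^+ 2 = 1 + s ^+ 2 + t ^+ 2 -> M ^+ 2 = 1 + s ^+ 2 ->
  B * (s * t) <= A * k * (M - 1) ->
  parallelogram_frame A B s t M^-1 0 (- (s * t) / (M * k)) (M / k).
Proof.
move=> A0 B0 st0 k0 M0 hk hM h.
have kn : k != 0 by rewrite gt_eqF.
have Mn : M != 0 by rewrite gt_eqF.
have Mk : M <= k.
  by rewrite -ler_sqr ?nnegrE ?(ltW k0) ?(ltW M0) // hk hM lerDl sqr_ge0.
split.
- have -> : M^-1 ^+ 2 + 0 ^+ 2 + (M^-1 * s + 0 * t) ^+ 2 =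
  (1 + s ^+ 2) / M ^+ 2 by field.
  by rewrite -hM divff // expf_neq0.
(* The factor [M ^+ 2 - s ^+ 2], which equals 1, is kept so that [field] succeeds before [hM] is
   used. *)
- have -> : (- (s * t) / (M * k)) ^+ 2 + (M / k) ^+ 2 +
      (- (s * t) / (M * k) * s + M / k * t) ^+ 2 =
      ((s * t) ^+ 2 + (M ^+ 2) ^+ 2 + (M ^+ 2 - s ^+ 2) ^+ 2 * t ^+ 2) /
      (M ^+ 2 * k ^+ 2) by field; rewrite kn.
  have -> : (s * t) ^+ 2 + (M ^+ 2) ^+ 2 + (M ^+ 2 - s ^+ 2) ^+ 2 * t ^+ 2 =
    M ^+ 2 * k ^+ 2.
    by rewrite hk hM; ring.
  by rewrite divff // mulf_neq0 // expf_neq0.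
- have -> : M^-1 * (- (s * t) / (M * k)) + 0 * (M / k) +
  (M^-1 * s + 0 * t) * (- (s * t) / (M * k) * s + M / k * t) =
   (M ^+ 2 - 1 - s ^+ 2) * s * t / (M ^+ 2 * k) by field; rewrite kn.
  by rewrite hM addrAC addrK subrr !mul0r.
- rewrite normrM normrN !ger0_norm // ?invr_ge0 ?mulr_ge0 ?(ltW M0) ?(ltW k0) //.
  have -> : A / M + B * (s * t / (M * k)) = (A * k + B * (s * t)) / (M * k)
    by field; rewrite kn.
  by rewrite ler_pdivrMr ?mulr_gt0 //; nra.
- rewrite normr0 mulr0 add0r ger0_norm ?divr_ge0 ?(ltW M0) ?(ltW k0) //.
  by rewrite ger_pMr // ler_pdivrMr // mul1r.
Qed.

(* The frame for which A g1 - B g2 is a positive multiple of A m1 - B m2; these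
   two vectors have lengths r and d. *)
Lemma diagonal_aligned (R : rcfType) (A B s t k r d x y : R) :
  0 < A -> 0 < B -> 0 < k -> 0 < r -> 0 < d ->
  k ^+ 2 = 1 + s ^+ 2 + t ^+ 2 -> r ^+ 2 = A ^+ 2 + B ^+ 2 ->
  d ^+ 2 = r ^+ 2 + (A * s - B * t) ^+ 2 ->
  x = B - t * (A * s - B * t) -> y = A + s * (A * s - B * t) ->
  x <= B * k -> y <= A * k ->
  parallelogram_frame A B s t
    ((A ^+ 2 * k + B * x) / (k * r * d)) ((B * y - A * B * k) / (k * r * d))
    ((A * x - A * B * k) / (k * r * d)) ((B ^+ 2 * k + A * y) / (k * r * d)).
Proof.
move=> A0 B0 k0 r0 d0 hk hr hd ex ey hx hy.
have kn : k != 0 by rewrite gt_eqF.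
have rn : r != 0 by rewrite gt_eqF.
have dn : d != 0 by rewrite gt_eqF.
have rd : r <= d.
  by rewrite -ler_sqr ?nnegrE ?(ltW r0) ?(ltW d0) // hd lerDl sqr_ge0.
have c0 : 0 < k * r * d by rewrite !mulr_gt0.
have cn : k * r * d != 0 by rewrite gt_eqF.
have cn2 : (k * r * d) ^+ 2 != 0 by rewrite expf_neq0.
have xy : 0 <= A * y + B * x.
  have -> : A * y + B * x = d ^+ 2 by rewrite hd hr ex ey; ring.
  exact: sqr_ge0.
(* The bounds [hx], [hy] fix the signs of all four coefficients; with the absolute values resolved,
   both containment conditions reduce to [r <= d]. *)
have p1 : 0 <= A ^+ 2 * k + B * x by nra.
have p2 : 0 <= B ^+ 2 * k + A * y by nra.
have p3 : B * y - A * B * k <= 0 by nra.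
have p4 : A * x - A * B * k <= 0 by nra.
set c := k * r * d in c0 cn cn2 *.
have hc : c ^+ 2 = (1 + s ^+ 2 + t ^+ 2) *
    ((A ^+ 2 + B ^+ 2) * (A ^+ 2 + B ^+ 2 + (A * s - B * t) ^+ 2)).
  by rewrite /c !exprMn hd hk hr mulrA.
have cw (u w : R) : (u / c * s + w / c * t) = (u * s + w * t) / c by field.
pose D2 := A ^+ 2 + B ^+ 2 + (A * s - B * t) ^+ 2.
(* Once [x] and [y] are expanded, [e1], [e2] and [e3] are polynomial identities in a free [k]; its
   square is substituted only afterwards. *)
have e1 : (A ^+ 2 * k + B * x) ^+ 2 + (B * y - A * B * k) ^+ 2 +
    ((A ^+ 2 * k + B * x) * s + (B * y - A * B * k) * t) ^+ 2 =
    k ^+ 2 * (A ^+ 2 * D2) + (1 + s ^+ 2 + t ^+ 2) * (B ^+ 2 * D2).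
  by rewrite ex ey /D2; ring.
have e2 : (A * x - A * B * k) ^+ 2 + (B ^+ 2 * k + A * y) ^+ 2 +
    ((A * x - A * B * k) * s + (B ^+ 2 * k + A * y) * t) ^+ 2 =
    k ^+ 2 * (B ^+ 2 * D2) + (1 + s ^+ 2 + t ^+ 2) * (A ^+ 2 * D2).
  by rewrite ex ey /D2; ring.
have e3 : (A ^+ 2 * k + B * x) * (A * x - A * B * k) +
    (B * y - A * B * k) * (B ^+ 2 * k + A * y) +
    ((A ^+ 2 * k + B * x) * s + (B * y - A * B * k) * t) *
    ((A * x - A * B * k) * s + (B ^+ 2 * k + A * y) * t) =
    (1 + s ^+ 2 + t ^+ 2) * (A * B * D2) - k ^+ 2 * (A * B * D2).
  by rewrite ex ey /D2; ring.
split.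
- rewrite cw !expr_div_n -!mulrDl e1; apply: (canLR (mulfK cn2)).
  by rewrite mul1r hc hk /D2; ring.
- rewrite cw !expr_div_n -!mulrDl e2; apply: (canLR (mulfK cn2)).
  by rewrite mul1r hc hk /D2; ring.
- by rewrite !cw !mulf_div -!mulrDl e3 hk subrr mul0r.
- rewrite !normrM !normfV (gtr0_norm c0) (ger0_norm p1) (ler0_norm p4).
  have -> : A * ((A ^+ 2 * k + B * x) / c) + B * (- (A * x - A * B * k) / c) =
    (A * k * (A ^+ 2 + B ^+ 2)) / c by field.
  rewrite ler_pdivrMr // -hr /c [r ^+ 2]expr2 !mulrA ler_wpM2l // !mulr_ge0 //;
    exact: ltW.
- rewrite !normrM !normfV (gtr0_norm c0) (ler0_norm p3) (ger0_norm p2).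
  have -> : A * (- (B * y - A * B * k) / c) + B * ((B ^+ 2 * k + A * y) / c) =
    (B * k * (A ^+ 2 + B ^+ 2)) / c by field.
  rewrite ler_pdivrMr // -hr /c [r ^+ 2]expr2 !mulrA ler_wpM2l // !mulr_ge0 //;
    exact: ltW.
Qed.

(** If neither side placement fits, the two failed inequalities, with [M <= k] and [N <= k], give
    exactly the bounds that the diagonal placement needs. *)
Lemma stretched_rectangle_frame (R : rcfType) (A B s t : R) :
  0 < A -> 0 < B -> exists x1 y1 x2 y2, parallelogram_frame A B s t x1 y1 x2 y2.
Proof.
(* Negating both [f2] and [m2] changes the sign of [t], and then of [y1] and [y2]. *)
move=> A0 B0; wlog st0 : s t / 0 <= s * t.
  move=> H; have [/H//|st] := leP 0 (s * t).
  have [|x1 [y1 [x2 [y2 [h1 h2 h3 h4 h5]]]]] := H s (- t);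
    first by rewrite mulrN oppr_ge0 ltW.
  exists x1, (- y1), x2, (- y2); split;
    rewrite ?sqrrN ?normrN // ?mulNr -?mulrN //.
  by rewrite opprK.
have pos (u v : R) : 0 < 1 + u ^+ 2 + v ^+ 2.
  by rewrite -addrA ltr_pwDl // addr_ge0 // sqr_ge0.
pose k := Num.sqrt (1 + s ^+ 2 + t ^+ 2).
have k0 : 0 < k by rewrite sqrtr_gt0.
have hk : k ^+ 2 = 1 + s ^+ 2 + t ^+ 2 by rewrite sqr_sqrtr // ltW.
pose M := Num.sqrt (1 + s ^+ 2).
have pos1 (u : R) : 0 < 1 + u ^+ 2 by rewrite ltr_pwDl // sqr_ge0.
have M0 : 0 < M by rewrite sqrtr_gt0.
have hM : M ^+ 2 = 1 + s ^+ 2 by rewrite sqr_sqrtr // ltW.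
pose N := Num.sqrt (1 + t ^+ 2).
have N0 : 0 < N by rewrite sqrtr_gt0.
have hN : N ^+ 2 = 1 + t ^+ 2 by rewrite sqr_sqrtr // ltW.
have [c2|c2] := leP (B * (s * t)) (A * k * (M - 1)).
  by do 4 eexists; apply: side_aligned c2.
have [c1|c1] := leP (A * (s * t)) (B * k * (N - 1)).
  (* Exchanging the two sides swaps [g1] with [g2] and the coordinates along [m1] and [m2]. *)
  have [] := @side_aligned _ B A t s k N => //; rewrite ?[t * s]mulrC //.
    by rewrite hk addrAC.
  move=> h1 h2 h3 h4 h5; exists (N / k), (- (s * t) / (N * k)), 0, N^-1; split.
  - by rewrite [_ ^+ 2 + _ ^+ 2]addrC [_ * s + _]addrC.
  - by rewrite [_ ^+ 2 + _ ^+ 2]addrC [_ * s + _]addrC.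
  - by rewrite -[RHS]h3; ring.
  - by rewrite addrC.
  - by rewrite addrC.
pose d := Num.sqrt (A ^+ 2 + B ^+ 2 + (A * s - B * t) ^+ 2).
pose r := Num.sqrt (A ^+ 2 + B ^+ 2).
have r20 : 0 < A ^+ 2 + B ^+ 2 by rewrite addr_gt0 // exprn_gt0.
have d20 : 0 < A ^+ 2 + B ^+ 2 + (A * s - B * t) ^+ 2.
  by rewrite ltr_pwDl // sqr_ge0.
have r0 : 0 < r by rewrite sqrtr_gt0.
have d0 : 0 < d by rewrite sqrtr_gt0.
have hr : r ^+ 2 = A ^+ 2 + B ^+ 2 by rewrite sqr_sqrtr // ltW.
have hd : d ^+ 2 = r ^+ 2 + (A * s - B * t) ^+ 2.
  by rewrite hr sqr_sqrtr // ltW.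
have Mk : M <= k.
  by rewrite -ler_sqr ?nnegrE ?(ltW M0) ?(ltW k0) // hk hM lerDl sqr_ge0.
have Nk : N <= k.
  by rewrite -ler_sqr ?nnegrE ?(ltW N0) ?(ltW k0) // hk hN lerD2r lerDl sqr_ge0.
have M1 : M * M <= k * M by rewrite ler_pM2r.
have N1 : N * N <= k * N by rewrite ler_pM2r.
do 4 eexists; apply: (diagonal_aligned (k := k) (r := r) (d := d)) => //;
  last 2 first.
- have -> : B - t * (A * s - B * t) = B * (N * N) - A * (s * t)
  by rewrite -expr2 hN; ring.
  nra.
- have -> : A + s * (A * s - B * t) = A * (M * M) - B * (s * t)
  by rewrite -expr2 hM; ring.
  nra.
Qed.

(** * The Euclidean inner product *)

Lemma dotE (R : realType) (u v : 'rV[R]_3) : dot u v = \sum_k u 0 k * v 0 k.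
Proof. by rewrite /dot mxE; apply: eq_bigr => k _; rewrite mxE. Qed.

Lemma dotC (R : realType) (u v : 'rV[R]_3) : dot u v = dot v u.
Proof. by rewrite !dotE; apply: eq_bigr => k _; rewrite mulrC. Qed.

Lemma dotDl (R : realType) (u v w : 'rV[R]_3) : dot (u + v) w = dot u w + dot v w.
Proof. by rewrite /dot mulmxDl mxE. Qed.

Lemma dotZl (R : realType) x (u w : 'rV[R]_3) : dot (x *: u) w = x * dot u w.
Proof. by rewrite /dot -scalemxAl mxE. Qed.

Lemma dotNl (R : realType) (u w : 'rV[R]_3) : dot (- u) w = - dot u w.
Proof. by rewrite -scaleN1r dotZl mulN1r. Qed.

Lemma dotDr (R : realType) (u v w : 'rV[R]_3) : dot w (u + v) = dot w u + dot w v.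
Proof. by rewrite dotC dotDl !(dotC w). Qed.

Lemma dotZr (R : realType) x (u w : 'rV[R]_3) : dot w (x *: u) = x * dot w u.
Proof. by rewrite dotC dotZl dotC. Qed.

Lemma dotNr (R : realType) (u w : 'rV[R]_3) : dot w (- u) = - dot w u.
Proof. by rewrite dotC dotNl dotC. Qed.

Definition dot_lin := (dotDl, dotDr, dotNl, dotNr, dotZl, dotZr).

Lemma dot_delta (R : realType) (u : 'rV[R]_3) i : dot (delta_mx 0 i) u = u 0 i.
Proof. by rewrite /dot -rowE !mxE. Qed.

Lemma dot_gt0 (R : realType) (u : 'rV[R]_3) : u != 0 -> 0 < dot u u.
Proof.
move=> u0; rewrite lt0r dotE sumr_ge0 ?andbT => [|k _];
  last by rewrite -expr2 sqr_ge0.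
apply: contra u0 => /eqP h; apply/eqP/rowP => k; rewrite mxE; apply/eqP.
have := psumr_eq0P _ h; move=> /(_ _ k isT).
by rewrite -expr2 => hk; rewrite -sqrf_eq0 hk // => i _; rewrite -expr2 sqr_ge0.
Qed.

Lemma dot_isom (R : realType) n (U : 'M[R]_(n, 3)) (x y : 'rV[R]_n) :
  U *m U^T = 1%:M -> dot (x *m U) (y *m U) = (x *m y^T) 0 0.
Proof. by move=> hU; rewrite /dot trmx_mul mulmxA -(mulmxA x) hU mulmx1. Qed.

(** * A rectangle in the shadow of a box *)

Definition frame (R : realType) (f1 f2 w : 'rV[R]_3) :=
  [/\ dot f1 f1 = 1, dot f2 f2 = 1, dot f1 f2 = 0, dot f1 w = 0 & dot f2 w = 0].

(* f1 and f2 are the images of e_j and e_k under the minimal rotation taking e_i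
   to w. *)
Lemma tilted_face_box (R : realType) (p q l : R) (w : 'rV[R]_3) (i j k : 'I_3) :
  i != j -> i != k -> j != k -> dot w w = 1 ->
  0 <= p <= l -> 0 <= q <= l -> 0 <= w 0 i -> `|w 0 j| + `|w 0 k| <= 1 + w 0 i ->
  let m1 := delta_mx 0 j - (w 0 j / (1 + w 0 i)) *: delta_mx 0 i in
  let m2 := delta_mx 0 k - (w 0 k / (1 + w 0 i)) *: delta_mx 0 i in
  let f1 := m1 - (w 0 j / (1 + w 0 i)) *: w in
  let f2 := m2 - (w 0 k / (1 + w 0 i)) *: w in
  frame f1 f2 w /\
   [/\ p * `|m1 0 j| + q * `|m2 0 j| = p,
     p * `|m1 0 k| + q * `|m2 0 k| = q &
     p * `|m1 0 i| + q * `|m2 0 i| <= l].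
Proof.
move=> ij ik jk ww /andP[p0 pl] /andP[q0 ql] wi h m1 m2 f1 f2.
have d0 : 0 < 1 + w 0 i by rewrite ltr_pwDl.
have dn : 1 + w 0 i != 0 by rewrite gt_eqF.
have dd (x y : 'I_3) : dot (delta_mx 0 x : 'rV[R]_3) (delta_mx 0 y) = (x == y)%:R.
  by rewrite dot_delta mxE.
have dw (x : 'I_3) : dot w (delta_mx 0 x : 'rV[R]_3) = w 0 x
  by rewrite dotC dot_delta.
have ji := ij; have ki := ik; have kj := jk; rewrite eq_sym in ji;
  rewrite eq_sym in ki; rewrite eq_sym in kj.
pose simp := (dot_lin, dd, fun x => dot_delta w x, dw, ww, eqxx, negbTE ij,
  negbTE ik, negbTE jk, negbTE ji, negbTE ki, negbTE kj).
split; first by split; rewrite /f1 /f2 /m1 /m2 !simp /= ?mulr0n ?mulr1n; field.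
split.
- rewrite !mxE !eqxx (negbTE ji) (negbTE jk) /= !mulr0 !subr0 normr1 normr0; ring.
- rewrite !mxE !eqxx (negbTE ki) (negbTE kj) /= !mulr0 !subr0 normr1 normr0; ring.
- rewrite !mxE !eqxx (negbTE ij) (negbTE ik) /= !mulr1 !sub0r !normrN
  !normf_div (gtr0_norm d0).
  rewrite !mulrA -mulrDl ler_pdivrMr //.
  apply: (@le_trans _ _ (l * `|w 0 j| + l * `|w 0 k|));
    first by rewrite lerD // ler_wpM2r.
  by rewrite -mulrDr ler_wpM2l // (le_trans p0).
Qed.

Lemma normr_coord_le1 (R : realType) (w : 'rV[R]_3) i : dot w w = 1 ->
  `|w 0 i| <= 1.
Proof.
move=> ww; rewrite -ler_sqr ?nnegrE // expr1n -normrX ger0_norm ?sqr_ge0 //.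
rewrite -ww dotE (bigD1 i) //= -expr2 lerDl sumr_ge0 // => k _.
by rewrite -expr2 sqr_ge0.
Qed.

(** The inequality says that the centered rectangle with sides [a *: f1] and [b *: f2] lifts along
    [w] into the centered box, vertex by vertex. *)
Lemma rectangle_in_shadow (R : realType) (a b c : R) (w : 'rV[R]_3) :
  0 < a -> a <= b -> b <= c -> dot w w = 1 ->
  exists (f1 f2 : 'rV[R]_3) (t1 t2 : R), frame f1 f2 w /\
    forall i, a * `|(f1 + t1 *: w) 0 i| + b * `|(f2 + t2 *: w) 0 i| <=
      tnth [tuple a; b; c] i.
Proof.
move=> a0 ab bc; set s := tnth _.
have key (i j k : 'I_3) : i != j -> i != k -> j != k ->
    (forall x, [|| x == i, x == j | x == k]) -> a <= s j -> b <= s k ->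
      b <= s i ->
  forall w : 'rV[R]_3, dot w w = 1 -> `|w 0 k| <= `|w 0 i| ->
  exists (f1 f2 : 'rV[R]_3) (t1 t2 : R), frame f1 f2 w /\
    forall i, a * `|(f1 + t1 *: w) 0 i| + b * `|(f2 + t2 *: w) 0 i| <= s i.
  move=> ij ik jk all sj sk si {}w; wlog wi : w / 0 <= w 0 i.
    move=> H ww wki; have [wi|wi] := leP 0 (w 0 i); first exact: H.
    have [||| f1 [f2 [t1 [t2 [[f11 f22 f12 f1w f2w] h]]]]] := H (- w).
    - by rewrite mxE oppr_ge0 ltW.
    - by rewrite !dot_lin opprK.
    - by rewrite !mxE !normrN.
    exists f1, f2, (- t1), (- t2); split; last by move=> x;
      rewrite !scaleNr -!scalerN.
    by split => //; apply/eqP; rewrite -oppr_eq0 -dotNr; apply/eqP.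
  move=> ww wki; have := @tilted_face_box _ a b (s i) w i j k ij ik jk ww.
  case=> //.
  - by rewrite (ltW a0) (le_trans ab).
  - by rewrite (le_trans (ltW a0) ab).
  - by rewrite lerD ?normr_coord_le1 // -[leRHS]ger0_norm.
  set f1 := _ - _ *: w; set f2 := _ - _ *: w.
  move=> fr [h1 h2 h3]; exists f1, f2, (w 0 j / (1 + w 0 i)),
    (w 0 k / (1 + w 0 i)).
  split=> // x; rewrite !subrK.
  by case/or3P: (all x) => /eqP ->; rewrite ?h1 ?h2 ?h3.
(* The axis of the edge [a] is always [j]; of the other two, [i] is the one with the larger
   coordinate of [w], and its edge is at least [b]. *)
move=> ww; have [h|h] := leP `|w 0 1| `|w 0 2%:R|.
- by apply: (key 2%:R 0 1) => //; case=> [[|[|[|]]]].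
- apply: (key 1 0 2%:R) => //; [by case=> [[|[|[|]]]] | exact: ltW].
Qed.

(** * Orthogonal projections and relative interiors *)

(* MathComp-Analysis has another [proj]. *)
Local Notation proj := Defs.proj.

Lemma projD (R : realType) (v x y : 'rV[R]_3) : proj v (x + y) =
  proj v x + proj v y.
Proof. by rewrite /proj dotDl mulrDl scalerDl opprD addrACA. Qed.

Lemma projZ (R : realType) k (v x : 'rV[R]_3) : proj v (k *: x) = k *: proj v x.
Proof. by rewrite /proj dotZl -mulrA -scalerA scalerBr. Qed.

Lemma projN (R : realType) (v x : 'rV[R]_3) : proj v (- x) = - proj v x.
Proof. by rewrite -scaleN1r projZ scaleN1r. Qed.

Lemma proj_normal (R : realType) (v x : 'rV[R]_3) : v != 0 ->
  dot (proj v x) v = 0.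
Proof.
by move=> /dot_gt0 v0; rewrite /proj dotDl dotNl dotZl divfK ?subrr // gt_eqF.
Qed.

Lemma proj_id (R : realType) (v x : 'rV[R]_3) : dot x v = 0 -> proj v x = x.
Proof. by move=> h; rewrite /proj h mul0r scale0r subr0. Qed.

Lemma proj_self (R : realType) (v : 'rV[R]_3) : v != 0 -> proj v v = 0.
Proof. by move=> /dot_gt0 v0; rewrite /proj divff ?gt_eqF // scale1r subrr. Qed.

Lemma unit_normal_proj (R : realType) (v : 'rV[R]_3) : v != 0 ->
  exists w, [/\ dot w w = 1, normal_plane w = normal_plane v & proj w = proj v].
Proof.
move=> /dot_gt0 v0; set q := dot v v in v0.
pose r := Num.sqrt q; have r0 : r != 0 by rewrite gt_eqF // sqrtr_gt0.
have r2 : r ^+ 2 = q by rewrite sqr_sqrtr // ltW.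
have ww : dot (r^-1 *: v) (r^-1 *: v) = 1.
  by rewrite !dot_lin -/q -r2; field.
exists (r^-1 *: v); split => //.
  apply/seteqP; split => x; rewrite /normal_plane /= dotZr; last by move=> ->;
    rewrite mulr0.
  by move/eqP; rewrite mulf_eq0 invr_eq0 (negbTE r0) => /eqP.
apply/funext => x; rewrite /proj ww dotZr scalerA -/q -r2; congr (x - _ *: v).
by field.
Qed.

Lemma mem_rel_interior (R : realType) (P A : set 'rV[R]_3) (z : 'rV[R]_3) : P z ->
  rel_interior P A z = within P (nbhs z) A.
Proof. by move=> Pz; rewrite /rel_interior /interior /=;
  case: (@nbhs_subspaceP _ P z). Qed.

Lemma nbhs_line (R : realType) (A : set 'rV[R]_3) (z d : 'rV[R]_3) :
  nbhs z A -> exists2 e : R, 0 < e & A (z + e *: d).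
Proof.
move=> zA; have : (fun e : R => z + e *: d) @ 0 --> z + 0 *: d.
  apply: cvgD; [exact: cvg_cst | exact: scalel_continuous].
rewrite scale0r addr0 => /(_ _ zA) /nbhs_ballP [e /= e0 h].
exists (e / 2); first by rewrite divr_gt0.
apply: h; rewrite /ball /= sub0r normrN gtr0_norm ?divr_gt0 //.
by rewrite ltr_pdivrMr // ltr_pMr // ltr1n.
Qed.

(** As [U] is orthogonal, [(y - p) *m U^T] recovers the coordinates of [y]; they are continuous, so
    finitely many strict bounds persist nearby. *)
Lemma interior_orthotope (R : realType) (p : 'rV[R]_3) (U : 'M[R]_3)
    (s : 3.-tuple R) (x : 'rV[R]_3) : U *m U^T = 1%:M ->
  (forall i, 0 < x 0 i < tnth s i) -> interior (orthotope p U s) (p + x *m U).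
Proof.
move=> hU hx; have hU' := mulmx1C hU.
pose f i (y : 'rV[R]_3) := ((y - p) *m U^T) 0 i.
have fx i : f i (p + x *m U) = x 0 i by rewrite /f addrC addKr -mulmxA hU mulmx1.
have fc i : continuous (f i).
  have -> : f i = fun y : 'rV[R]_3 => \sum_k (y 0 k - p 0 k) * U^T k i.
    by apply/funext => y; rewrite /f mxE; apply: eq_bigr => k _; rewrite !mxE.
  have hk k : continuous (fun y : 'rV[R]_3 => y 0 k - p 0 k).
    by move=> y; apply: (@cvgB _ _ _ (nbhs y));
      [exact: coord_continuous|exact: cvg_cst].
  apply: continuous_big => [|k _]; first exact: add_continuous.
  by move=> y; apply: (@cvgMr_tmp _ _ (nbhs y)); exact: hk.
have : \forall y \near p + x *m U, forall i, 0 < f i y < tnth s i.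
  apply: (@filter_forall _ _ _ (nbhs (p + x *m U))) => i;
    have /andP[x0 xs] := hx i.
  near=> y; apply/andP; split; near: y.
    by apply: (cvgr_gt _ (fc i _)); rewrite fx.
  by apply: (cvgr_lt _ (fc i _)); rewrite fx.
apply: filterS => y hy; exists ((y - p) *m U^T).
  by move=> i; have /andP[/ltW h1 /ltW h2] := hy i; apply/andP.
by rewrite -mulmxA hU' mulmx1 addrC subrK.
Unshelve. all: by end_near. Qed.

(** The translation [x + (y - proj v x)] is a continuous section of the projection over the plane,
    and it passes through [x]. *)
Lemma rel_interior_proj (R : realType) (v x : 'rV[R]_3) (B : set 'rV[R]_3) :
  v != 0 -> interior B x ->
  rel_interior (normal_plane v) (proj v @` B) (proj v x).
Proof.
move=> v0 Bx; rewrite mem_rel_interior; last exact: proj_normal.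
have : (fun y => x + (y - proj v x)) @ proj v x --> x + (proj v x - proj v x).
  apply: (@cvgD _ _ _ (nbhs (proj v x))); first exact: cvg_cst.
  by apply: (@cvgB _ _ _ (nbhs (proj v x))); [exact: cvg_id | exact: cvg_cst].
rewrite subrr addr0 => /(_ _ Bx); rewrite /within /=.
apply: (@filterS _ (nbhs (proj v x))) => y By yv;
  exists (x + (y - proj v x)) => //.
by rewrite !projD projN (proj_id yv) (proj_id (proj_normal _ v0)) addrC subrK.
Qed.

(** Openness allows pushing [z] away from the projected center [proj v (p + h *m U)] by a factor
    [1 + e]; shrinking a preimage back by this factor makes its bounds strict. *)
Lemma rel_interior_lift (R : realType) (v p : 'rV[R]_3) (U : 'M[R]_3)
    (s : 3.-tuple R) (h z : 'rV[R]_3) : v != 0 ->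
  (forall i, 0 < tnth s i) -> (forall i, h 0 i = tnth s i / 2) ->
  normal_plane v z ->
  rel_interior (normal_plane v) (proj v @` orthotope p U s) z ->
  exists y : 'rV[R]_3, (forall i, `|y 0 i| < tnth s i / 2) /\
    z = proj v (p + h *m U) + proj v (y *m U).
Proof.
move=> v0 s0 hh vz; rewrite mem_rel_interior // /within /=.
set c := p + _; move=> /(nbhs_line (z - proj v c)) [e e0].
case=> [|b [x hx <-] eqb].
  by rewrite /normal_plane /= dotDl dotZl dotDl dotNl proj_normal // vz; ring.
have e1 : 0 < 1 + e by rewrite addr_gt0.
exists ((1 + e)^-1 *: (x - h)); split.
  move=> i; rewrite !mxE hh normrM gtr0_norm ?invr_gt0 // mulrC ltr_pdivrMr //.
  have /andP[h0 h1] := hx i; have si := s0 i.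
  apply: (@le_lt_trans _ _ (tnth s i / 2)); first by rewrite ler_norml; lra.
  nra.
rewrite -scalemxAl projZ.
have -> : (x - h) *m U = (p + x *m U) - c
  by rewrite /c mulmxBl opprD addrACA subrr add0r.
rewrite projD projN eqb.
apply: (scalerI (a := 1 + e)); first by rewrite gt_eqF.
rewrite [RHS]scalerDr scalerA divff ?gt_eqF // scale1r !scalerDl !scale1r
  scalerBr.
by apply/rowP => i; rewrite !mxE; ring.
Qed.

(** * From a rectangle to a passage *)

Lemma unit_neq0 (R : realType) (v : 'rV[R]_3) : dot v v = 1 -> v != 0.
Proof.
by apply: contra_eq_neq => ->; rewrite /dot mul0mx mxE eq_sym oner_eq0.
Qed.

(** [W^T] has two columns, hence rank below 3 and a nonzero kernel. *)
Lemma unit_normal (R : realType) (W : 'M[R]_(2, 3)) :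
  exists n : 'rV[R]_3, [/\ n != 0, n *m n^T = 1%:M & W *m n^T = 0].
Proof.
have : kermx W^T != 0.
  rewrite -mxrank_eq0 mxrank_ker subn_eq0 -ltnNge.
  exact: leq_ltn_trans (rank_leq_col _) _.
case/rowV0Pn => n /sub_kermxP hn n0; have [w [ww wn _]] := unit_normal_proj n0.
exists w; split.
- exact: unit_neq0.
- by rewrite [LHS]mx11_scalar -[X in X%:M]/(dot w w) ww.
- apply/matrixP => i j; rewrite !ord1 mxE [RHS]mxE.
  have : normal_plane w (row i W).
    rewrite wn /normal_plane /= dotC dotE; have /matrixP/(_ 0 i) := hn;
      rewrite !mxE => h.
    by rewrite -[RHS]h; apply: eq_bigr => k _; rewrite !mxE.
  by rewrite /normal_plane /= dotE => h; rewrite -[RHS]h;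
    apply: eq_bigr => k _; rewrite !mxE.
Qed.

Lemma passes_of_rectangle (R : realType) (a b c l : R) (B : set 'rV[R]_3) :
  interior_contains_rectangle (l * a) (l * b) B -> passes_through a b c l B.
Proof.
case=> Q [[p [W [hW ->]]] QB]; have [n [n0 nn Wn]] := unit_normal W.
(* The box is erected on [Q] along [n]; the size is written [2 + 1] for the block lemmas. *)
pose U : 'M[R]_(2 + 1, 3) := col_mx W n.
have hU : U *m U^T = 1%:M.
  rewrite /U tr_col_mx mul_col_row hW nn Wn.
  by rewrite -[n *m W^T]trmxK trmx_mul trmxK Wn trmx0 -scalar_mx_block.
exists n, (orthotope p (U : 'M[R]_3) [tuple l * a; l * b; l * c]); split => //.
  by exists p, U.
move=> _ [_ [x hx <-] <-]; pose y : 'rV[R]_(2 + 1) := x.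
(* The third edge is parallel to [n], so the projection kills it. *)
have -> : proj n (p + x *m (U : 'M[R]_3)) = proj n (p + lsubmx y *m W).
  have -> : x *m (U : 'M[R]_3) = lsubmx y *m W + rsubmx y *m n
    by rewrite -mul_row_col hsubmxK.
  by rewrite addrA [LHS]projD [rsubmx y]mx11_scalar mul_scalar_mx projZ
    proj_self // scaler0 addr0.
apply: rel_interior_proj => //; apply: QB; exists (lsubmx y) => // i.
have := hx (lshift 1 i); rewrite mxE.
by case: i => [[|[|//]]] hi.
Qed.

(** * From a passage to a rectangle *)

(** The mean of [|y + z|] and [|y - z|] is the larger of [|y|] and [|z|]. Coordinatewise, a centered
    box around two points contains the parallelogram spanned by them and their opposites. *)
Lemma abs_comb_lt (R : realType) (e1 e2 y z S : R) :
  `|e1| <= 1 / 2 -> `|e2| <= 1 / 2 -> `|y| < S -> `|z| < S ->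
  `|e1 * (y + z) + e2 * (y - z)| < S.
Proof.
move=> h1 h2 hy hz.
apply: (@le_lt_trans _ _ (1 / 2 * `|y + z| + 1 / 2 * `|y - z|)).
  by apply: le_trans (ler_normD _ _) _; rewrite !normrM lerD // ler_wpM2r.
move: hy hz; rewrite !ltr_norml => /andP[y1 y2] /andP[z1 z2].
case: (lerP 0 (y + z)) => h; case: (lerP 0 (y - z)) => h';
  rewrite ?(ger0_norm h) ?(ltr0_norm h) ?(ger0_norm h') ?(ltr0_norm h'); lra.
Qed.

(** [Y], [Z] and their opposites are the vertices of a parallelogram with sides [A *: n1] and
    [B *: n2], where [n1] and [n2] play the roles of m1 and m2 in [parallelogram_frame]. *)
Lemma parallelogram_contains_rectangle (R : realType) (A B : R) (s : 3.-tuple R)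
    (v f1 f2 Y Z : 'rV[R]_3) : 0 < A -> 0 < B -> dot v v = 1 -> frame f1 f2 v ->
  (forall i, `|Y 0 i| < tnth s i / 2) -> (forall i, `|Z 0 i| < tnth s i / 2) ->
  proj v Y = (A / 2) *: f1 + (B / 2) *: f2 ->
  proj v Z = (A / 2) *: f1 - (B / 2) *: f2 ->
  exists g1 g2 : 'rV[R]_3,
    [/\ dot g1 g1 = 1, dot g2 g2 = 1, dot g1 g2 = 0 &
     forall t1 t2, `|t1| <= A / 2 -> `|t2| <= B / 2 ->
       forall i, `|(t1 *: g1 + t2 *: g2) 0 i| < tnth s i / 2].
Proof.
move=> A0 B0 vv [f11 f22 f12 f1v f2v] hY hZ pY pZ.
have An : A != 0 by rewrite gt_eqF.
have Bn : B != 0 by rewrite gt_eqF.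
pose n1 := A^-1 *: (Y + Z); pose n2 := B^-1 *: (Y - Z).
have e1 : n1 = f1 + dot n1 v *: v.
  have : proj v n1 = f1.
    by rewrite projZ projD pY pZ; apply/rowP => i; rewrite !mxE; field.
  by rewrite /proj vv divr1 => <-; rewrite subrK.
have e2 : n2 = f2 + dot n2 v *: v.
  have : proj v n2 = f2.
    by rewrite projZ projD projN pY pZ; apply/rowP => i; rewrite !mxE; field.
  by rewrite /proj vv divr1 => <-; rewrite subrK.
set s1 := dot n1 v in e1; set s2 := dot n2 v in e2.
have vf1 : dot v f1 = 0 by rewrite dotC.
have vf2 : dot v f2 = 0 by rewrite dotC.
have f21 : dot f2 f1 = 0 by rewrite dotC.
pose simp := (dot_lin, f11, f22, f12, f21, f1v, f2v, vf1, vf2, vv).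
have [x1 [y1 [x2 [y2 [h1 h2 h3 hA hB]]]]] :=
  stretched_rectangle_frame s1 s2 A0 B0.
exists (x1 *: n1 + y1 *: n2), (x2 *: n1 + y2 *: n2); split.
- by rewrite -[RHS]h1 e1 e2 !simp; ring.
- by rewrite -[RHS]h2 e1 e2 !simp; ring.
- by rewrite -[RHS]h3 e1 e2 !simp; ring.
move=> t1 t2 ht1 ht2 i.
have -> : (t1 *: (x1 *: n1 + y1 *: n2) + t2 *: (x2 *: n1 + y2 *: n2)) 0 i =
   (t1 * x1 + t2 * x2) / A * (Y 0 i + Z 0 i) +
   (t1 * y1 + t2 * y2) / B * (Y 0 i - Z 0 i).
  by rewrite !mxE; field; rewrite An Bn.
(* The last two conditions of the frame bound both coefficients by 1/2. *)
apply: abs_comb_lt => //.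
- rewrite normrM normfV (gtr0_norm A0) ler_pdivrMr //.
  apply: le_trans (ler_normD _ _) _; rewrite !normrM.
  apply: (@le_trans _ _ (A / 2 * `|x1| + B / 2 * `|x2|)); last by lra.
  by rewrite lerD // ler_wpM2r.
- rewrite normrM normfV (gtr0_norm B0) ler_pdivrMr //.
  apply: le_trans (ler_normD _ _) _; rewrite !normrM.
  apply: (@le_trans _ _ (A / 2 * `|y1| + B / 2 * `|y2|)); last by lra.
  by rewrite lerD // ler_wpM2r.
Qed.

Lemma rectangle_of_passes (R : realType) (a b c l : R) (S : set 'rV[R]_3) :
  0 < a -> a <= b -> b <= c -> is_box a b c S -> 0 < l ->
  passes_through a b c l S -> interior_contains_rectangle (l * a) (l * b) S.
Proof.
move=> a0 ab bc [p [U [hU ->]]] l0 [v0 [_ [v00 [p' [U' [hU' ->]]]]]].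
set s := [tuple a; b; c]; set s' := [tuple _; _; _].
have b0 : 0 < b by exact: lt_le_trans ab.
have c0 : 0 < c by exact: lt_le_trans bc.
have s0 i : 0 < tnth s i by case: i => [[|[|[|]]]].
have s's i : tnth s' i = l * tnth s i by case: i => [[|[|[|]]]].
have [v [vv <- <-]] := unit_normal_proj v00; move=> sub.
have v1 := unit_neq0 vv.
have hU'2 := mulmx1C hU'; have hU2 := mulmx1C hU.
(* [w] is the passage direction in the axes of the inner box. *)
pose w := v *m U'^T; have wv : w *m U' = v by rewrite -mulmxA hU'2 mulmx1.
have ww : dot w w = 1 by rewrite dot_isom ?trmxK.
have [f1 [f2 [t1 [t2 [fr hf]]]]] := rectangle_in_shadow a0 ab bc ww.
pose A := l * a; pose B := l * b.
have A0 : 0 < A by rewrite mulr_gt0.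
have B0 : 0 < B by rewrite mulr_gt0.
pose h : 'rV[R]_3 := \row_i (tnth s i / 2).
(* The signs select a vertex of the shadow rectangle; [y] is its lift to the open outer box, in
   coordinates taken from the center. *)
have lift (e1 e2 : R) : `|e1| = 1 -> `|e2| = 1 -> exists y : 'rV[R]_3,
    (forall i, `|y 0 i| < tnth s i / 2) /\
    proj v (p' + l *: h *m U') + (e1 * A / 2) *: (f1 *m U') +
      (e2 * B / 2) *: (f2 *m U') = proj v (p + h *m U) + proj v (y *m U).
  move=> he1 he2.
  pose x := l *: h + (e1 * A / 2) *: (f1 + t1 *: w) +
    (e2 * B / 2) *: (f2 + t2 *: w).
  have xE : proj v (p' + x *m U') = proj v (p' + l *: h *m U') +
      (e1 * A / 2) *: (f1 *m U') + (e2 * B / 2) *: (f2 *m U').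
    have [_ _ _ f1w f2w] := fr.
    have f1v : dot (f1 *m U') v = 0 by rewrite -wv dot_isom.
    have f2v : dot (f2 *m U') v = 0 by rewrite -wv dot_isom.
    rewrite /x !mulmxDl -!scalemxAl !mulmxDl -!scalemxAl wv !addrA !projD
      !projZ !projD !projZ.
    by rewrite proj_self // !scaler0 !addr0 (proj_id f1v) (proj_id f2v).
  rewrite -xE; apply: rel_interior_lift => //.
  - by move=> i; rewrite mxE.
  - exact: proj_normal.
  apply: sub; exists (p' + x *m U') => //; exists x => // i.
  have hl := hf i; rewrite -/s in hl; rewrite s's.
  have -> : x 0 i = l * (tnth s i / 2 + e1 * (a / 2 * (f1 + t1 *: w) 0 i) +
      e2 * (b / 2 * (f2 + t2 *: w) 0 i)).
    by rewrite /x /h /A /B !mxE; field.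
  rewrite pmulr_rge0 // ler_pM2l //.
  have : `|e1 * (a / 2 * (f1 + t1 *: w) 0 i) +
      e2 * (b / 2 * (f2 + t2 *: w) 0 i)| <= tnth s i / 2.
    apply: le_trans (ler_normD _ _) _; rewrite !normrM he1 he2.
    rewrite !mul1r (gtr0_norm a0) (gtr0_norm b0) normfV normr_nat; lra.
  by rewrite ler_norml; lra.
have n1 : `|1| = 1 :> R := normr1 _.
have n1' : `|-1| = 1 :> R by rewrite normrN normr1.
have [ypp [hpp epp]] := lift _ _ n1 n1; have [ypm [hpm epm]] := lift _ _ n1 n1'.
have [ymp [hmp emp]] := lift _ _ n1' n1; have [ymm [hmm emm]] := lift _ _ n1' n1'.
(* Half differences of opposite lifts cancel the unknown offset between the two projected
   centers. *)
pose Y : 'rV[R]_3 := 2^-1 *: (ypp - ymm);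
  pose Z : 'rV[R]_3 := 2^-1 *: (ypm - ymp).
have [f11 f22 f12 f1w f2w] := fr.
have avg (y1 y2 : 'rV[R]_3) : (forall i, `|y1 0 i| < tnth s i / 2) ->
  (forall i, `|y2 0 i| < tnth s i / 2) ->
   forall i, `|(2^-1 *: (y1 - y2) : 'rV[R]_3) 0 i| < tnth s i / 2.
  move=> h1 h2 i; have := h1 i; have := h2 i; rewrite !mxE !ltr_norml; lra.
have pYU : proj v (Y *m U) = (A / 2) *: (f1 *m U') + (B / 2) *: (f2 *m U').
  rewrite -scalemxAl mulmxBl projZ projD projN.
  have -> : proj v (ypp *m U) - proj v (ymm *m U) =
    (proj v (p + h *m U) + proj v (ypp *m U)) -
    (proj v (p + h *m U) + proj v (ymm *m U)).
    by rewrite [in RHS]opprD addrACA subrr add0r.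
  by rewrite -epp -emm; move: (proj v (p' + _)) => q; apply/rowP => i;
    rewrite !mxE; field.
have pZU : proj v (Z *m U) = (A / 2) *: (f1 *m U') - (B / 2) *: (f2 *m U').
  rewrite -scalemxAl mulmxBl projZ projD projN.
  have -> : proj v (ypm *m U) - proj v (ymp *m U) =
    (proj v (p + h *m U) + proj v (ypm *m U)) -
    (proj v (p + h *m U) + proj v (ymp *m U)).
    by rewrite [in RHS]opprD addrACA subrr add0r.
  by rewrite -epm -emp; move: (proj v (p' + _)) => q; apply/rowP => i;
    rewrite !mxE; field.
(* The parallelogram is treated in the axes of the outer box, where [u] is the passage direction. *)
pose u := v *m U^T.
have uu : dot u u = 1 by rewrite dot_isom ?trmxK.
have projU (x : 'rV[R]_3) : proj u (x *m U^T) = proj v x *m U^T.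
  by rewrite /proj !dot_isom ?trmxK // mulmxBl -scalemxAl.
have UK (x : 'rV[R]_3) : x *m U *m U^T = x by rewrite -mulmxA hU mulmx1.
have dotU' (x y : 'rV[R]_3) : dot (x *m U' *m U^T) (y *m U' *m U^T) = dot x y.
  by rewrite dot_isom ?trmxK // -/(dot _ _) dot_isom.
have [|||||g1 [g2 [g11 g22 g12 hg]]] :=
  @parallelogram_contains_rectangle R A B s u
    (f1 *m U' *m U^T) (f2 *m U' *m U^T) Y Z A0 B0 uu.
- by split; rewrite /u -?wv dotU'.
- exact: avg.
- exact: avg.
- by rewrite -[Y]UK projU pYU mulmxDl -!scalemxAl.
- by rewrite -[Z]UK projU pZU mulmxBl -!scalemxAl.
pose G : 'M[R]_(1 + 1, 3) := col_mx g1 g2.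
have GG : G *m G^T = 1%:M.
  have d1 (x y : 'rV[R]_3) : x *m y^T = (dot x y)%:M by rewrite [LHS]mx11_scalar.
  rewrite /G tr_col_mx mul_col_row !d1 g11 g22 g12 dotC g12.
  by rewrite !raddf0 -scalar_mx_block.
(* [orthotope] is anchored at a vertex, so the center [h] is shifted by [m] to a corner of the
   rectangle. *)
pose m : 'rV[R]_3 := - (A / 2) *: g1 - (B / 2) *: g2.
exists (orthotope (p + (h + m) *m U) (G *m U : 'M[R]_(2, 3)) [tuple A; B]); split.
  exists (p + (h + m) *m U), (G *m U : 'M[R]_(2, 3)); split => //.
  by rewrite trmx_mul mulmxA -(mulmxA G) hU mulmx1.
move=> _ [x hx <-]; pose y : 'rV[R]_(1 + 1) := x.
have yE : y *m G = (x 0 0) *: g1 + (x 0 1) *: g2.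
  rewrite -{1}[y]hsubmxK mul_row_col.
  rewrite [lsubmx y]mx11_scalar [rsubmx y]mx11_scalar !mul_scalar_mx !mxE.
  by congr (x 0 _ *: _ + x 0 _ *: _); apply/val_inj.
have -> : p + (h + m) *m U + x *m (G *m U) =
  p + (h + ((x 0 0 - A / 2) *: g1 + (x 0 1 - B / 2) *: g2)) *m U.
  rewrite -[x]/y mulmxA yE -addrA -mulmxDl -addrA; congr (p + (h + _) *m U).
  by rewrite /m; apply/rowP => i; rewrite !mxE; ring.
apply: interior_orthotope => // i.
have : `|((x 0 0 - A / 2) *: g1 + (x 0 1 - B / 2) *: g2) 0 i| < tnth s i / 2.
  have /andP[? ?] : 0 <= x 0 0 <= A := hx 0.
  have /andP[? ?] : 0 <= x 0 1 <= B := hx 1.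
  by apply: hg; rewrite ler_norml; lra.
rewrite [X in _ -> _ < X < _]mxE [h 0 i]mxE ltr_norml; lra.
Qed.

Unset Implicit Arguments.

Theorem theorem2 (R : realType) (a b c : R) (B : set 'rV[R]_3)
    (ha : 0 < a) (hab : a <= b) (hbc : b <= c) (hB : is_box a b c B) :
  (forall lambda : R, 0 < lambda ->
     passes_through a b c lambda B ->
     interior_contains_rectangle (lambda * a) (lambda * b) B) /\
  nieuwland a b c B = rectangle_sup a b B.
Proof.
split=> [l|]; first exact: rectangle_of_passes.
(* The two suprema range over the same set of ratios. *)
rewrite /nieuwland /rectangle_sup; congr (ereal_sup (_ @` _)).
apply/seteqP; split => l [l0 h]; split => //; first exact: rectangle_of_passes h.
exact: passes_of_rectangle.
Qed.
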